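(* Let $n\ge 2$ and $m\ge 3$ be integers, and let $\Gamma=H(n,m)$ be the Hamming graph. Then $\mathrm{Aut}(\Gamma)\cong \mathrm{Sym}([m])\, wr_I\, \mathrm{Sym}([n])$, where $I=[n]=\{1,2,\dots,n\}$.
   Context: Graphs are simple and undirected. For a set $\Omega$ with $m$ elements, the Hamming graph $H(n,m)$ is the graph with vertex set $\Omega^n$ in which two vertices ($n$-tuples) are adjacent if and only if they differ in exactly one coordinate. $\mathrm{Aut}(\Gamma)$ is the group, under composition, of all graph automorphisms of $\Gamma$ (bijections of the vertex set that preserve adjacency and non-adjacency). For a positive integer $k$, $[k]=\{1,\dots,k\}$, and $\mathrm{Sym}([k])$ is the group of all permutations of $[k]$. Wreath product: let $K$ and $H$ be groups and let $H$ act on a nonempty finite set $I$, the action being written on the right as $\gamma\mapsto\gamma^{x}$ for $\gamma\in I$, $x\in H$, with $\gamma^{xy}=(\gamma^x)^y$. Let $Fun(I,K)$ be the group of all functions $I\to K$ under pointwise multiplication. The group $H$ acts on $Fun(I,K)$ by $f^{x}(\gamma)=f(\gamma^{x^{-1}})$. The wreath product $K\, wr_I\, H$ is the corresponding semidirect product $Fun(I,K)\rtimes H$, i.e. the set $Fun(I,K)\times H$ with multiplication $(f,x)(g,y)=(f\,g^{x^{-1}},\,xy)$. In the claim, $K=\mathrm{Sym}([m])$ and $H=\mathrm{Sym}([n])$ acts on $I=[n]$ in the natural way. *)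

(* Defs.v *)
From HB Require Import structures.
From mathcomp Require Import all_boot all_fingroup.

Set Implicit Arguments.
Unset Strict Implicit.
Unset Printing Implicit Defensive.

Local Open Scope group_scope.

Record sgraph := SGraph {
  vertex :> finType;
  adj : rel vertex;
  adj_sym : symmetric adj;
  adj_irr : irreflexive adj }.

Section GraphAut.
Variable G : sgraph.

Definition graph_aut : {set {perm G}} :=
  [set s : {perm G} | [forall u, forall v, adj (s u) (s v) == adj u v]].

Lemma graph_autP (s : {perm G}) :
  reflect (forall u v, adj (s u) (s v) = adj u v) (s \in graph_aut).
Proof.
rewrite inE; apply: (iffP forallP) => h u => [v|].
  exact/eqP/(forallP (h u)).
by apply/forallP=> v; rewrite h.
Qed.

Lemma graph_aut_group_set : group_set graph_aut.
Proof.
apply/group_setP; split=> [|s t /graph_autP hs /graph_autP ht].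
  by apply/graph_autP=> u v; rewrite !perm1.
by apply/graph_autP=> u v; rewrite !permM ht hs.
Qed.

Canonical graph_aut_group := Group graph_aut_group_set.

End GraphAut.

Section Hamming.
Variables (n : nat) (Omega : finType).
Implicit Types u v : n.-tuple Omega.

Definition hamming_adj : rel (n.-tuple Omega) :=
  fun u v => #|[set i : 'I_n | tnth u i != tnth v i]| == 1%N.

Lemma hamming_sym : symmetric hamming_adj.
Proof.
by move=> u v; congr (_ == _); apply: eq_card => i; rewrite !inE eq_sym.
Qed.

Lemma hamming_irr : irreflexive hamming_adj.
Proof.
move=> u; rewrite /hamming_adj (_ : [set _ | _] = set0) ?cards0 //.
by apply/setP=> i; rewrite !inE eqxx.
Qed.

Definition hamming : sgraph := SGraph hamming_sym hamming_irr.

End Hamming.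

Section Wreath.
Variables (K H : finGroupType) (I : finType).

(* Library actions are right actions: to i (x * y) = to (to i x) y. *)
Definition fun_act (to : {action H &-> I}) (f : {ffun I -> K}) (x : H) :
    {ffun I -> K} :=
  [ffun i => f (to i x^-1)].

(* A copy of the product type, so that its group structure is not confused
   with the direct product; [to] only determines the multiplication. *)
Inductive wreath (to : {action H &-> I}) : predArgType :=
  Wreath of {ffun I -> K} * H.

Variable to : {action H &-> I}.

Definition wreath_pair (w : wreath to) : {ffun I -> K} * H :=
  let: Wreath p := w in p.

HB.instance Definition _ := [isNew for wreath_pair].
HB.instance Definition _ := [Finite of wreath to by <:].

Definition wreath_mul (u v : wreath to) : wreath to :=
  let: Wreath (f, x) := u in
  let: Wreath (g, y) := v in
  Wreath to (f * fun_act to g x^-1, x * y).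

Definition wreath_one : wreath to := Wreath to (1, 1).

Definition wreath_inv (u : wreath to) : wreath to :=
  let: Wreath (f, x) := u in Wreath to (fun_act to f^-1 x, x^-1).

Lemma fun_act1 f : fun_act to f 1 = f.
Proof. by apply/ffunP=> i; rewrite ffunE invg1 act1. Qed.

Lemma fun_actM f x y : fun_act to f (x * y) = fun_act to (fun_act to f x) y.
Proof. by apply/ffunP=> i; rewrite !ffunE invMg actM. Qed.

Lemma fun_act_mul f g x :
  fun_act to (f * g) x = fun_act to f x * fun_act to g x.
Proof. by apply/ffunP=> i; rewrite !ffunE. Qed.

Lemma wreath_mulA : associative wreath_mul.
Proof.
move=> [[f x]] [[g y]] [[h z]] /=.
by rewrite fun_act_mul -fun_actM invMg !mulgA.
Qed.

Lemma wreath_mul1 : left_id wreath_one wreath_mul.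
Proof. by move=> [[f x]] /=; rewrite invg1 fun_act1 !mul1g. Qed.

Lemma wreath_mulV : left_inverse wreath_one wreath_inv wreath_mul.
Proof.
move=> [[f x]] /=; rewrite invgK -fun_act_mul !mulVg; congr (Wreath to (_, _)).
by apply/ffunP=> i; rewrite !ffunE.
Qed.

HB.instance Definition _ := Finite_isGroup.Build (wreath to)
  wreath_mulA wreath_mul1 wreath_mulV.

End Wreath.

Arguments wreath K {H I} to.

(* Main.v *)
Require Import Defs.
From mathcomp Require Import all_boot all_fingroup.

(** The wreath product acts on tuples by permuting coordinates and by permuting
    the letters in each coordinate separately; this action preserves the number
    of coordinates in which two tuples differ, hence adjacency, and it is
    faithful because there are two distinct letters.  The content of the
    theorem is that every automorphism [s] arises in this way.

    Call a line of direction [i] a set of tuples that agree off coordinate [i].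
    Two neighbours of a vertex lie on a common line through it exactly when they
    are equal or adjacent ([agree_off_inj]), so [s] maps each line into a line
    ([line_image]).  Parallel lines go to parallel lines ([parallel_step]): for
    neighbouring parallel lines the reason is that opposite sides of a
    quadrangle whose diagonals are not edges have the same direction.  Since
    the graph is connected, [s] induces a map [x] on directions that does not
    depend on the line, and [x] is injective since edges at a vertex in distinct
    directions have nonadjacent ends.  Changing a coordinate [j] of [u]
    therefore changes only coordinate [x j] of [s u], so coordinate [x i] of
    [s u] is a function of coordinate [i] of [u] alone
    ([hamming_aut_coordinates]).  This is the shape of an element of the wreath
    product. *)

Set Implicit Arguments.
Unset Strict Implicit.
Unset Printing Implicit Defensive.

Local Open Scope group_scope.

(** * Changing one coordinate of a tuple *)

Section Update.
Variables (n : nat) (Omega : finType).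
Implicit Types (u v w p q r t : n.-tuple Omega) (i j k l : 'I_n) (a b : Omega).

Definition update u i a : n.-tuple Omega :=
  [tuple if l == i then a else tnth u l | l < n].

Definition agree_off k p q := forall l, l != k -> tnth p l = tnth q l.

Lemma tnth_update u i a l :
  tnth (update u i a) l = if l == i then a else tnth u l.
Proof. by rewrite tnth_mktuple. Qed.

Lemma update_id u i : update u i (tnth u i) = u.
Proof. by apply/eq_from_tnth => l; rewrite tnth_update; case: eqP => // ->. Qed.

Lemma updateK u i a b : update (update u i a) i b = update u i b.
Proof. by apply/eq_from_tnth => l; rewrite !tnth_update; case: eqP. Qed.

Lemma updateC u i j a b :
  i != j -> update (update u i a) j b = update (update u j b) i a.
Proof.
move=> nij; apply/eq_from_tnth => l; rewrite !tnth_update.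
by case: eqP => // ->; rewrite eq_sym (negPf nij).
Qed.

Lemma agree_off_sym k p q : agree_off k p q -> agree_off k q p.
Proof. by move=> h l nlk; rewrite h. Qed.

Lemma agree_off_trans k p q r :
  agree_off k p q -> agree_off k q r -> agree_off k p r.
Proof. by move=> h1 h2 l nlk; rewrite h1 // h2. Qed.

Lemma agree_off_neq k p q :
  agree_off k p q -> p != q -> tnth p k != tnth q k.
Proof.
move=> h; apply: contraNN => /eqP e; apply/eqP/eq_from_tnth => l.
by case: (eqVneq l k) => [-> //|]; apply: h.
Qed.

Lemma agree_off_update u i a b : agree_off i (update u i a) (update u i b).
Proof. by move=> l /negPf nli; rewrite !tnth_update nli. Qed.

Lemma agree_off_updatel u i a : agree_off i u (update u i a).
Proof. by move=> l /negPf nli; rewrite tnth_update nli. Qed.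

Lemma update_neq u i a : a != tnth u i -> u != update u i a.
Proof.
apply: contraNN => /eqP/(congr1 (fun w => tnth w i)).
by rewrite tnth_update eqxx => ->.
Qed.

(** Any tuple is reached from any other by correcting, one at a time, only the
    coordinates in which they differ.  The restriction to those coordinates is
    what allows an induction that keeps the common coordinates fixed. *)
Lemma update_ind (P : n.-tuple Omega -> Prop) u v :
    (forall w j, tnth u j != tnth v j -> P w -> P (update w j (tnth v j))) ->
  P u -> P v.
Proof.
move=> step Pu.
pose js := [seq j <- enum 'I_n | tnth u j != tnth v j].
pose walk := foldr (fun j w => update w j (tnth v j)) u.
have tnth_walk s l :
    tnth (walk s) l = if l \in s then tnth v l else tnth u l.
  elim: s => //= j s IH; rewrite tnth_update in_cons IH.
  by case: eqP => // ->.
have -> : v = walk js.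
  apply/eq_from_tnth => l; rewrite tnth_walk mem_filter mem_enum andbT.
  by case: eqP => /= [->|].
have: all (fun j => tnth u j != tnth v j) js by apply: filter_all.
by elim: js => //= j s IH /andP[nj /IH Ps]; apply: step.
Qed.

(** * Adjacency in the Hamming graph *)

Lemma hamming_adjP p q :
  reflect (p != q /\ exists k, agree_off k p q) (hamming_adj p q).
Proof.
apply: (iffP cards1P) => [[k dk]|[npq [k hk]]].
  have diff l : (tnth p l != tnth q l) = (l == k).
    by move/setP/(_ l): dk; rewrite !inE.
  split; first by apply/eqP => e; have := diff k; rewrite e !eqxx.
  by exists k => l; rewrite -diff negbK => /eqP.
exists k; apply/setP => l; rewrite !inE.
case: (eqVneq l k) => [->|nlk]; first exact: agree_off_neq hk npq.
by rewrite hk // eqxx.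
Qed.

Definition close p q := (p == q) || hamming_adj p q.

Lemma agree_off_close k p q : agree_off k p q -> close p q.
Proof.
rewrite /close; case: eqVneq => //= npq h.
by apply/hamming_adjP; split=> //; exists k.
Qed.

(** If [k] and [l] were distinct, [q] and [r] would differ in both. *)
Lemma agree_off_inj k l p q r :
    agree_off k p q -> agree_off l p r -> p != q -> p != r -> close q r ->
  k = l.
Proof.
move=> hk hl npq npr cqr; apply/eqP/negPn/negP => nkl.
have dk : tnth q k != tnth r k.
  by rewrite -(hl k nkl) eq_sym; apply: agree_off_neq hk npq.
have dl : tnth q l != tnth r l.
  by rewrite -(hk l) 1?eq_sym //; rewrite eq_sym; apply: agree_off_neq hl npr.
case/orP: cqr => [/eqP e|/hamming_adjP[_ [c hc]]]; first by rewrite e eqxx in dk.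
have ec l' : tnth q l' != tnth r l' -> l' = c.
  by move=> d; apply/eqP; apply: contraNT d => /hc ->.
by rewrite (ec _ dk) (ec _ dl) eqxx in nkl.
Qed.

End Update.

Arguments agree_off_updatel {n Omega} u i a.

(** * Automorphisms of the Hamming graph *)

Section Automorphism.
Variables (n : nat) (Omega : finType).
Variable s : {perm hamming n Omega}.
Hypothesis s_aut : s \in graph_aut (hamming n Omega).
Implicit Types (u v w : n.-tuple Omega) (i j k l : 'I_n) (a b : Omega).

Lemma aut_close u v : close (s u) (s v) = close u v.
Proof.
have /graph_autP/(_ u v) /= e := s_aut.
by rewrite /close e (inj_eq perm_inj).
Qed.

Lemma aut_neq u v : (s u != s v) = (u != v).
Proof. by rewrite (inj_eq perm_inj). Qed.

Lemma aut_agree_off i u v :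
  u != v -> agree_off i u v -> exists k, agree_off k (s u) (s v).
Proof.
move=> nuv h; have: hamming_adj u v by apply/hamming_adjP; split=> //; exists i.
by have /graph_autP/(_ u v) /= <- := s_aut => /hamming_adjP[].
Qed.

(** The image under [s] of the line of direction [i] through [u] lies on a line
    of direction [k]. *)
Definition line_to u i k := forall a, agree_off k (s u) (s (update u i a)).

(** Three points of a line are pairwise adjacent, and so are their images; the
    direction [k] is read off from any one edge of the line at [u]. *)
Lemma line_image u i : 1 < #|Omega| -> exists k, line_to u i k.
Proof.
move=> Omega_gt1.
have [a0 na0] : exists a0, a0 != tnth u i.
  have: 0 < #|predC1 (tnth u i)| by rewrite cardC1 -ltnS prednK // ltnW.
  by case/card_gt0P => a; exists a.
have [k hk] := aut_agree_off (update_neq na0) (agree_off_updatel u i a0).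
exists k => a; case: (eqVneq a (tnth u i)) => [->|na]; first by rewrite update_id.
have [l hl] := aut_agree_off (update_neq na) (agree_off_updatel u i a).
suff -> : k = l by [].
apply: agree_off_inj hk hl _ _ _; rewrite ?aut_neq ?update_neq // aut_close.
exact/agree_off_close/agree_off_update.
Qed.

(** For [i <> j] the vertices [u], [u1], [u3], [u2] below form a quadrangle
    whose diagonals are not edges.  In its image, the side from [u] to [u2] has
    a direction other than [k], since otherwise the diagonal from [u1] to [u2]
    would be an edge.  If the side from [u2] to [u3] had a direction other than
    [k] too, then coordinate [k] would be the same at [u] and [u3]; since it
    differs at [u1], the side from [u1] to [u3] would have direction [k], like
    the side from [u] to [u1], and the diagonal from [u] to [u3] would be an
    edge. *)
Lemma parallel_step u i j k b : line_to u i k -> line_to (update u j b) i k.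
Proof.
move=> h a; have [eji|nji] := eqVneq j i.
  rewrite eji updateK; apply: agree_off_trans (h a).
  exact: agree_off_sym.
have [->|nb] := eqVneq b (tnth u j); first by rewrite update_id; apply: h.
have [ea|na] := eqVneq a (tnth u i).
  have -> : a = tnth (update u j b) i by rewrite tnth_update eq_sym (negPf nji).
  by rewrite update_id.
pose u1 := update u i a; pose u2 := update u j b; pose u3 := update u2 i a.
have u3E : u3 = update u1 j b by rewrite /u3 updateC.
have h1 : agree_off i u u1 := agree_off_updatel u i a.
have h2 : agree_off j u u2 := agree_off_updatel u j b.
have h13 : agree_off j u1 u3 by rewrite u3E; apply: agree_off_updatel.
have h23 : agree_off i u2 u3 := agree_off_updatel u2 i a.
have n1 : u != u1 := update_neq na.
have n2 : u != u2 := update_neq nb.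
have n13 : u1 != u3.
  by rewrite u3E; apply: update_neq; rewrite tnth_update (negPf nji).
have n23 : u2 != u3.
  by apply: update_neq; rewrite tnth_update [i == j]eq_sym (negPf nji).
have nc12 : ~~ close u1 u2.
  by apply: contraNN nji => c; rewrite (agree_off_inj h1 h2 n1 n2 c).
have nc03 : ~~ close u u3.
  apply: contraNN nji => c; apply/eqP/esym.
  by apply: agree_off_inj (agree_off_sym h1) h13 _ n13 c; rewrite eq_sym.
rewrite -/u2 -/u3; have hk : agree_off k (s u) (s u1) := h a.
have [k2 hk2] := aut_agree_off n2 h2.
have [c hc] := aut_agree_off n13 h13.
have [d hd] := aut_agree_off n23 h23.
have [<- //|ndk] := eqVneq d k.
have nk2 : k2 != k.
  apply: contraNneq nc12 => e; rewrite e in hk2.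
  rewrite -aut_close; apply: agree_off_close.
  exact: agree_off_trans (agree_off_sym hk) hk2.
have ck : c = k.
  apply/eqP/negPn/negP => nck.
  have: tnth (s u) k != tnth (s u1) k.
    by apply: agree_off_neq hk _; rewrite aut_neq.
  by rewrite hk2 1?eq_sym // hd 1?eq_sym // hc 1?eq_sym // eqxx.
rewrite ck in hc; case/negP: nc03; rewrite -aut_close.
exact: agree_off_close (agree_off_trans hk hc).
Qed.

Lemma parallel u v i k : line_to u i k -> line_to v i k.
Proof.
apply: (@update_ind _ _ (fun w => line_to w i k)) => w j _.
exact: parallel_step.
Qed.

(** By [parallel], one map [x] on directions serves all vertices; the letter
    permutation [F i] is what [s] does to coordinate [i] on a single line of
    direction [i], namely the one through a fixed constant tuple. *)
Lemma hamming_aut_coordinates :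
    1 < #|Omega| ->
  exists (x : 'S_n) (F : 'I_n -> {perm Omega}),
    forall u i, tnth (s u) (x i) = F i (tnth u i).
Proof.
move=> Omega_gt1; have [a [b [_ _ nab]]] := card_gt1P Omega_gt1.
pose u0 : n.-tuple Omega := [tuple a | _ < n].
have tnth_u0 l : tnth u0 l = a by rewrite tnth_mktuple.
have [x0 hx0] := fin_all_exists (fun i => line_image u0 i Omega_gt1).
have {hx0} line u i : line_to u i (x0 i) := parallel u (hx0 i).
have x0_inj : injective x0.
  move=> i j e; have nu l : u0 != update u0 l b.
    by rewrite update_neq // tnth_u0 eq_sym.
  apply: agree_off_inj (agree_off_updatel u0 i b) _ (nu i) (nu j) _.
    exact: agree_off_updatel.
  rewrite -aut_close; apply: (@agree_off_close _ _ (x0 i)).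
  apply: agree_off_trans (agree_off_sym (line u0 i b)) _.
  by rewrite e; apply: line.
(* Going from [u] to [v] only through coordinates in which they differ avoids
   [i], and by injectivity of [x0] no such step changes coordinate [x0 i]. *)
have depends u v i :
    tnth u i = tnth v i -> tnth (s u) (x0 i) = tnth (s v) (x0 i).
  move=> e; pose P w := tnth (s u) (x0 i) = tnth (s w) (x0 i).
  apply: (@update_ind _ _ P u v) => // w j nj; rewrite /P => ->.
  apply: line; rewrite (inj_eq x0_inj).
  by apply: contraNneq nj => <-; rewrite e.
pose F0 i c := tnth (s (update u0 i c)) (x0 i).
have F0_inj i : injective (F0 i).
  move=> c d e; apply/eqP/negPn/negP => ncd.
  have cd : update u0 i c != update u0 i d.
    apply: contraNneq ncd => /(congr1 (fun w => tnth w i)).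
    by rewrite !tnth_update eqxx => ->.
  have h : agree_off (x0 i) (s (update u0 i c)) (s (update u0 i d)).
    exact: agree_off_trans (agree_off_sym (line u0 i c)) (line u0 i d).
  rewrite -aut_neq in cd.
  by have := agree_off_neq h cd; rewrite -!/(F0 _ _) e eqxx.
exists (perm x0_inj), (fun i => perm (@F0_inj i)) => u i.
rewrite !permE; apply: depends.
by rewrite tnth_update eqxx.
Qed.

End Automorphism.

(** * The action of the wreath product on tuples *)

Section WreathAction.
Variables (n : nat) (Omega : finType).

Local Notation W := (wreath 'S_#|Omega| ('P%act : {action 'S_n &-> 'I_n})).
Implicit Types (w : W) (u : n.-tuple Omega) (i : 'I_n).

Definition letter_act (p : 'S_#|Omega|) (c : Omega) : Omega :=
  enum_val (p (enum_rank c)).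

Lemma letter_act_inj p : injective (letter_act p).
Proof. by move=> c d /enum_val_inj/perm_inj/enum_rank_inj. Qed.

Lemma letter_act_of_perm (q : {perm Omega}) :
  exists p : 'S_#|Omega|, letter_act p =1 q.
Proof.
pose p0 (k : 'I_#|Omega|) := enum_rank (q (enum_val k)).
have p0_inj : injective p0 by move=> k l /enum_rank_inj/perm_inj/enum_val_inj.
by exists (perm p0_inj) => c; rewrite /letter_act permE /p0 !enum_rankK.
Qed.

(** The entry at [i] is moved to position [x i], so that composition matches the
    product [(f i * g (x i), x * y)] of the wreath product. *)
Definition tuple_act w u : n.-tuple Omega :=
  let: (f, x) := wreath_pair w in
  [tuple letter_act (f (x^-1 j)) (tnth u (x^-1 j)) | j < n].

Lemma tnth_tuple_act w u i :
  tnth (tuple_act w u) ((wreath_pair w).2 i) =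
    letter_act ((wreath_pair w).1 i) (tnth u i).
Proof.
by case: w => [[f x]]; rewrite /tuple_act /= tnth_mktuple permK.
Qed.

Lemma tuple_actE w u v :
    (forall i, tnth v ((wreath_pair w).2 i) =
                 letter_act ((wreath_pair w).1 i) (tnth u i)) ->
  tuple_act w u = v.
Proof.
move=> h; apply/eq_from_tnth => j.
by rewrite -(permKV (wreath_pair w).2 j) tnth_tuple_act h.
Qed.

Lemma tuple_act_inj w : injective (tuple_act w).
Proof.
move=> u v e; apply/eq_from_tnth => i.
by apply: (@letter_act_inj ((wreath_pair w).1 i)); rewrite -!tnth_tuple_act e.
Qed.

Lemma tuple_actM (w1 w2 : W) u :
  tuple_act (w1 * w2) u = tuple_act w2 (tuple_act w1 u).
Proof.
apply: tuple_actE => i.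
case: w1 w2 => [[f x]] [[g y]].
rewrite /= permM.
have := @tnth_tuple_act (Wreath _ (g, y)) (tuple_act (Wreath _ (f, x)) u) (x i).
rewrite /= => ->.
have /= -> := @tnth_tuple_act (Wreath _ (f, x)) u i.
by rewrite !ffunE /letter_act invgK permM enum_valK.
Qed.

Definition tuple_perm w : {perm hamming n Omega} := perm (@tuple_act_inj w).

Lemma tuple_permM : {in [set: W] &, {morph tuple_perm : w1 w2 / w1 * w2}}.
Proof.
by move=> w1 w2 _ _; apply/permP => u; rewrite permM !permE; apply: tuple_actM.
Qed.

Canonical tuple_perm_morphism := Morphism tuple_permM.

Lemma tuple_perm_aut w : tuple_perm w \in graph_aut (hamming n Omega).
Proof.
apply/graph_autP => u v; rewrite !permE /= /hamming_adj; congr (_ == _).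
rewrite -[RHS](card_imset _ (@perm_inj _ (wreath_pair w).2)).
apply: eq_card => j; rewrite -(permKV (wreath_pair w).2 j).
rewrite (mem_imset _ _ perm_inj) !inE !tnth_tuple_act.
by rewrite (inj_eq (@letter_act_inj _)).
Qed.

Lemma tuple_perm_injm : 1 < #|Omega| -> 'injm tuple_perm.
Proof.
move=> Omega_gt1; have [a [b [_ _ nab]]] := card_gt1P Omega_gt1.
apply/subsetP => w /morphpreP[_ /set1P w1].
have triv u i :
    tnth u ((wreath_pair w).2 i) = letter_act ((wreath_pair w).1 i) (tnth u i).
  rewrite -tnth_tuple_act; congr (tnth _ _).
  have := congr1 (fun p : {perm hamming n Omega} => p u) w1.
  by rewrite permE perm1.
case: w triv {w1} => [[f x]] /= triv; apply/set1P.
have x1 i : x i = i.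
  apply/eqP; apply: contraNT nab => nxi.
  (* Two tuples with the same entry at [i] and different ones at [x i]. *)
  pose u0 : n.-tuple Omega := [tuple a | _ < n].
  have := triv u0 i; have := triv (update u0 (x i) b) i.
  by rewrite !tnth_update eqxx eq_sym (negPf nxi) !tnth_mktuple => -> <-.
congr (Wreath _ (_, _)); last by apply/permP => i; rewrite x1 perm1.
apply/ffunP => i; rewrite ffunE; apply/permP => k; rewrite perm1.
have := triv [tuple enum_val k | _ < n] i.
by rewrite !tnth_mktuple /letter_act enum_valK => /enum_val_inj.
Qed.

Lemma tuple_perm_im :
  1 < #|Omega| -> tuple_perm @* [set: W] = graph_aut (hamming n Omega).
Proof.
move=> Omega_gt1; apply/eqP; rewrite eqEsubset; apply/andP; split.
  by apply/subsetP => s /morphimP[w _ _ ->]; apply: tuple_perm_aut.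
apply/subsetP => s s_aut.
have [x [F hF]] := hamming_aut_coordinates s_aut Omega_gt1.
have [f hf] := fin_all_exists (fun i => letter_act_of_perm (F i)).
apply/morphimP; exists (Wreath _ (finfun f, x)); rewrite ?inE //.
apply/permP => u; rewrite permE; apply/esym/tuple_actE => i /=.
by rewrite ffunE hf hF.
Qed.

End WreathAction.

Theorem theorem3p4 (n m : nat) (Omega : finType)
    (hn : (2 <= n)%N) (hm : (3 <= m)%N) (hOmega : #|Omega| = m) :
  (graph_aut (hamming n Omega)
     \isog [set: wreath 'S_m ('P%act : {action 'S_n &-> 'I_n})])%g.
Proof.
subst m; have Omega_gt1 : 1 < #|Omega| by apply: ltnW.
rewrite -(tuple_perm_im n Omega_gt1) isog_sym.
exact: sub_isog (subxx _) (tuple_perm_injm n Omega_gt1).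
Qed.
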